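(* Suppose $\mathcal{C}$ is a braided strict monoidal category, $\mathcal{M}$ is a balanced strict monoidal category with braiding $\beta$ and twist $\theta$, and $F\colon\mathcal{C}\to\mathcal{M}$ is a braided monoidal functor. Let $A\colon\mathcal{C}\to\mathrm{End}(\mathcal{M})$ be the action functor given by $A(X)(M)=X\cdot M=F(X)\otimes M$ and $f\cdot g=F(f)\otimes g$, for objects $X$ of $\mathcal{C}$, $M$ of $\mathcal{M}$, and morphisms $f$ of $\mathcal{C}$, $g$ of $\mathcal{M}$. (a) For each object $X$ of $\mathcal{C}$, the collection $\Xi_X:=(\xi_X\cdot 1_M)_{M\in\mathrm{Ob}(\mathcal{M})}$ is an endomorphism of the functor $A(X)\colon\mathcal{M}\to\mathcal{M}$ (i.e. a natural transformation from $A(X)$ to itself). (b) The collection $(\Xi_X)_{X\in\mathrm{Ob}(\mathcal{C})}$ is an endomorphism of the functor $A$ (i.e. a natural transformation from $A$ to itself).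
   Context: All categories are essentially small. ''Monoidal functor'' means strong monoidal functor. $\mathrm{End}(\mathcal{M})$ is the strict monoidal category of endofunctors of $\mathcal{M}$ and natural transformations. For $f\colon X\to Y$ in $\mathcal{C}$, $A(f)$ is the natural transformation with components $F(f)\otimes 1_M$. A strict monoidal category with braiding $\beta_{X,Y}\colon X\otimes Y\to Y\otimes X$ is balanced if it has a twist, i.e. a natural isomorphism $\theta$ from the identity functor to itself with $\theta_{\mathbf{1}}=1_{\mathbf{1}}$ (where $\mathbf{1}$ is the unit object) and $\theta_{X\otimes Y}=\beta_{Y,X}\circ(\theta_Y\otimes\theta_X)\circ\beta_{X,Y}$. Here $\xi_X\colon X\to X$ is the morphism $\xi_{\mathbf{1},X}$ of the affinization $\mathrm{Aff}(\mathcal{C})$ (the category obtained from $\mathcal{C}$ by adjoining invertible morphisms $\xi_{X,Y}\colon X\otimes Y\to Y\otimes X$ subject to $\xi_{X,Y\otimes Z}=\xi_{Z\otimes X,Y}\circ\xi_{X\otimes Y,Z}$ and $\xi_{X_2,Y_2}\circ(g\otimes f)=(f\otimes g)\circ\xi_{X_1,Y_1}$ for $f\colon Y_1\to Y_2$, $g\colon X_1\to X_2$ in $\mathcal{C}$), and $\xi_X\cdot 1_M$ denotes its action on $1_M$, which is the morphism $$\xi_X\cdot 1_M:=\beta_{M,F(X)}\circ(1_M\otimes\theta_{F(X)})\circ\beta_{F(X),M}\colon F(X)\otimes M\to F(X)\otimes M.$$ *)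

(* Defs.v *)
From Stdlib Require Import FunctionalExtensionality ProofIrrelevance.

Set Implicit Arguments.
Unset Strict Implicit.
Unset Printing Implicit Defensive.

Declare Scope cat_scope.
Delimit Scope cat_scope with cat.
Open Scope cat_scope.

Reserved Notation "X ~> Y" (at level 90, right associativity).
Reserved Notation "g ∘ f" (at level 40, left associativity).
Reserved Notation "X ⊗ Y" (at level 38, left associativity).

Record Category := {
  Ob :> Type;
  Hom : Ob -> Ob -> Type;
  idm : forall X, Hom X X;
  comp : forall X Y Z, Hom Y Z -> Hom X Y -> Hom X Z;
  comp_idl : forall X Y (f : Hom X Y), comp (idm Y) f = f;
  comp_idr : forall X Y (f : Hom X Y), comp f (idm X) = f;
  compA : forall W X Y Z (h : Hom Y Z) (g : Hom X Y) (f : Hom W X),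
    comp h (comp g f) = comp (comp h g) f
}.

Arguments idm {c} X.

Notation "X ~> Y" := (Hom X Y) : cat_scope.
Notation "g ∘ f" := (comp g f) : cat_scope.

Definition is_iso (C : Category) (X Y : C) (f : X ~> Y) : Prop :=
  exists g : Y ~> X, g ∘ f = idm X /\ f ∘ g = idm Y.

(* An equality of objects, viewed as an (identity) morphism; it is only used to
   state laws between morphisms whose types agree up to a strict equality of
   objects that is not a conversion. *)
Definition eq_hom (C : Category) (X Y : C) (e : X = Y) : X ~> Y :=
  match e in _ = Z return X ~> Z with eq_refl => idm X end.

Record Functor (C D : Category) := {
  fob :> C -> D;
  fmap : forall X Y : C, (X ~> Y) -> (fob X ~> fob Y);
  fmap_id : forall X : C, fmap (idm X) = idm (fob X);
  fmap_comp : forall (X Y Z : C) (g : Y ~> Z) (f : X ~> Y),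
    fmap (g ∘ f) = fmap g ∘ fmap f
}.

Arguments fmap {C D} F {X Y} _ : rename.

Definition id_functor (C : Category) : Functor C C :=
  {| fob := fun X => X;
     fmap := fun X Y f => f;
     fmap_id := fun X => eq_refl;
     fmap_comp := fun X Y Z g f => eq_refl |}.

Definition is_natural (C D : Category) (F G : Functor C D)
    (eta : forall X : C, F X ~> G X) : Prop :=
  forall (X Y : C) (f : X ~> Y), eta Y ∘ fmap F f = fmap G f ∘ eta X.

Record NatTrans (C D : Category) (F G : Functor C D) := MkNatTrans {
  nt_app :> forall X : C, F X ~> G X;
  nt_natural : is_natural nt_app
}.

Lemma nat_trans_eq (C D : Category) (F G : Functor C D) (s t : NatTrans F G) :
  (forall X, s X = t X) -> s = t.
Proof.
destruct s as [s Hs], t as [t Ht]; simpl; intros E.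
assert (Est : s = t) by (apply functional_extensionality_dep; exact E).
subst t; f_equal; apply proof_irrelevance.
Qed.

Lemma id_nat_natural (C D : Category) (F : Functor C D) :
  @is_natural C D F F (fun X => idm (F X)).
Proof. intros X Y f; now rewrite comp_idl, comp_idr. Qed.

Lemma comp_nat_natural (C D : Category) (F G H : Functor C D)
    (t : NatTrans G H) (s : NatTrans F G) :
  is_natural (fun X => t X ∘ s X).
Proof.
intros X Y f; rewrite <- compA, (nt_natural s), compA, (nt_natural t).
symmetry; apply compA.
Qed.

Definition EndCat (C : Category) : Category.
Proof.
refine {| Ob := Functor C C;
          Hom := fun F G => NatTrans F G;
          idm := fun F => MkNatTrans (@id_nat_natural C C F);
          comp := fun F G H t s => MkNatTrans (comp_nat_natural t s) |}.
- abstract (intros; apply nat_trans_eq; intros; apply comp_idl).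
- abstract (intros; apply nat_trans_eq; intros; apply comp_idr).
- abstract (intros; apply nat_trans_eq; intros; apply compA).
Defined.

(* The tensor product is strictly associative and unital: on objects by
   [tensA], [tens1o], [tenso1], and on morphisms by [tens_homA], [tens1_hom],
   [tens_hom1], which say [(f ⊗ g) ⊗ h = f ⊗ (g ⊗ h)], [1 ⊗ f = f] and
   [f ⊗ 1 = f] along these equalities. *)
Record StrictMonoidalCategory := {
  smc_cat :> Category;
  unit_ob : smc_cat;
  tens : smc_cat -> smc_cat -> smc_cat;
  tens_hom : forall X X' Y Y' : smc_cat,
    (X ~> X') -> (Y ~> Y') -> (tens X Y ~> tens X' Y');
  tens_id : forall X Y : smc_cat, tens_hom (idm X) (idm Y) = idm (tens X Y);
  tens_comp : forall (X X' X'' Y Y' Y'' : smc_cat)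
      (f' : X' ~> X'') (f : X ~> X') (g' : Y' ~> Y'') (g : Y ~> Y'),
    tens_hom (f' ∘ f) (g' ∘ g) = tens_hom f' g' ∘ tens_hom f g;
  tensA : forall X Y Z : smc_cat, tens (tens X Y) Z = tens X (tens Y Z);
  tens1o : forall X : smc_cat, tens unit_ob X = X;
  tenso1 : forall X : smc_cat, tens X unit_ob = X;
  tens_homA : forall (X X' Y Y' Z Z' : smc_cat)
      (f : X ~> X') (g : Y ~> Y') (h : Z ~> Z'),
    eq_hom (tensA X' Y' Z') ∘ tens_hom (tens_hom f g) h =
    tens_hom f (tens_hom g h) ∘ eq_hom (tensA X Y Z);
  tens1_hom : forall (X X' : smc_cat) (f : X ~> X'),
    eq_hom (tens1o X') ∘ tens_hom (idm unit_ob) f = f ∘ eq_hom (tens1o X);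
  tens_hom1 : forall (X X' : smc_cat) (f : X ~> X'),
    eq_hom (tenso1 X') ∘ tens_hom f (idm unit_ob) = f ∘ eq_hom (tenso1 X)
}.

Arguments unit_ob {s}.
Arguments tensA {s} X Y Z.
Arguments tens1o {s} X.
Arguments tenso1 {s} X.

Notation "X ⊗ Y" := (tens X Y) : cat_scope.
Notation "f ⊗h g" := (tens_hom f g) (at level 38, left associativity) : cat_scope.

(* [braid_hexagon1] and [braid_hexagon2] are
   [β_{X,Y⊗Z} = (1_Y ⊗ β_{X,Z}) ∘ (β_{X,Y} ⊗ 1_Z)] and
   [β_{X⊗Y,Z} = (β_{X,Z} ⊗ 1_Y) ∘ (1_X ⊗ β_{Y,Z})]. *)
Record BraidedStrictMonoidalCategory := {
  bsmc_smc :> StrictMonoidalCategory;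
  braid : forall X Y : bsmc_smc, X ⊗ Y ~> Y ⊗ X;
  braid_iso : forall X Y : bsmc_smc, is_iso (braid X Y);
  braid_natural : forall (X X' Y Y' : bsmc_smc) (f : X ~> X') (g : Y ~> Y'),
    braid X' Y' ∘ (f ⊗h g) = (g ⊗h f) ∘ braid X Y;
  braid_hexagon1 : forall X Y Z : bsmc_smc,
    eq_hom (tensA Y Z X) ∘ braid X (Y ⊗ Z) ∘ eq_hom (tensA X Y Z) =
    (idm Y ⊗h braid X Z) ∘ eq_hom (tensA Y X Z) ∘ (braid X Y ⊗h idm Z);
  braid_hexagon2 : forall X Y Z : bsmc_smc,
    eq_hom (eq_sym (tensA Z X Y)) ∘ braid (X ⊗ Y) Z
      ∘ eq_hom (eq_sym (tensA X Y Z)) =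
    (braid X Z ⊗h idm Y) ∘ eq_hom (eq_sym (tensA X Z Y))
      ∘ (idm X ⊗h braid Y Z)
}.

Arguments braid {b} X Y.

Record BalancedStrictMonoidalCategory := {
  bal_bsmc :> BraidedStrictMonoidalCategory;
  twist : forall X : bal_bsmc, X ~> X;
  twist_natural :
    @is_natural _ _ (id_functor bal_bsmc) (id_functor bal_bsmc) twist;
  twist_iso : forall X : bal_bsmc, is_iso (twist X);
  twist_unit : twist unit_ob = idm unit_ob;
  twist_tens : forall X Y : bal_bsmc,
    twist (X ⊗ Y) = braid Y X ∘ (twist Y ⊗h twist X) ∘ braid X Y
}.

Arguments twist {b} X.

Record MonoidalFunctor (C D : StrictMonoidalCategory) := {
  mf_functor :> Functor C D;
  mf_unit : unit_ob ~> mf_functor unit_ob;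
  mf_unit_iso : is_iso mf_unit;
  mf_tens : forall X Y : C, mf_functor X ⊗ mf_functor Y ~> mf_functor (X ⊗ Y);
  mf_tens_iso : forall X Y : C, is_iso (mf_tens X Y);
  mf_tens_natural : forall (X X' Y Y' : C) (f : X ~> X') (g : Y ~> Y'),
    mf_tens X' Y' ∘ (fmap mf_functor f ⊗h fmap mf_functor g) =
    fmap mf_functor (f ⊗h g) ∘ mf_tens X Y;
  mf_assoc : forall X Y Z : C,
    fmap mf_functor (eq_hom (tensA X Y Z)) ∘ mf_tens (X ⊗ Y) Z
      ∘ (mf_tens X Y ⊗h idm (mf_functor Z)) =
    mf_tens X (Y ⊗ Z) ∘ (idm (mf_functor X) ⊗h mf_tens Y Z)
      ∘ eq_hom (tensA (mf_functor X) (mf_functor Y) (mf_functor Z));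
  mf_unitl : forall X : C,
    fmap mf_functor (eq_hom (tens1o X)) ∘ mf_tens unit_ob X
      ∘ (mf_unit ⊗h idm (mf_functor X)) = eq_hom (tens1o (mf_functor X));
  mf_unitr : forall X : C,
    fmap mf_functor (eq_hom (tenso1 X)) ∘ mf_tens X unit_ob
      ∘ (idm (mf_functor X) ⊗h mf_unit) = eq_hom (tenso1 (mf_functor X))
}.

Record BraidedMonoidalFunctor (C D : BraidedStrictMonoidalCategory) := {
  bmf_mf :> MonoidalFunctor C D;
  bmf_braid : forall X Y : C,
    fmap bmf_mf (braid X Y) ∘ mf_tens bmf_mf X Y =
    mf_tens bmf_mf Y X ∘ braid (bmf_mf X) (bmf_mf Y)
}.

Section Action.

Variables (C M : StrictMonoidalCategory) (F : MonoidalFunctor C M).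

Definition act_hom (X Y : C) (f : X ~> Y) (N P : M) (g : N ~> P) :
  F X ⊗ N ~> F Y ⊗ P := fmap F f ⊗h g.

Lemma act_hom_id (X : C) (N : M) :
  act_hom (idm X) (idm N) = idm (F X ⊗ N).
Proof. unfold act_hom; rewrite fmap_id; apply tens_id. Qed.

Lemma act_hom_comp (X Y Z : C) (f' : Y ~> Z) (f : X ~> Y)
    (N P Q : M) (g' : P ~> Q) (g : N ~> P) :
  act_hom (f' ∘ f) (g' ∘ g) = act_hom f' g' ∘ act_hom f g.
Proof. unfold act_hom; rewrite fmap_comp; apply tens_comp. Qed.

Definition act_ob (X : C) : Functor M M.
Proof.
refine {| fob := fun N => F X ⊗ N;
          fmap := fun N P g => act_hom (idm X) g |}.
- abstract (intros; apply act_hom_id).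
- abstract (intros; rewrite <- act_hom_comp; now rewrite comp_idl).
Defined.

Lemma act_mor_natural (X Y : C) (f : X ~> Y) :
  @is_natural M M (act_ob X) (act_ob Y) (fun N => act_hom f (idm N)).
Proof.
intros N P g; simpl; rewrite <- !act_hom_comp.
now rewrite !comp_idl, !comp_idr.
Qed.

Definition act_mor (X Y : C) (f : X ~> Y) : NatTrans (act_ob X) (act_ob Y) :=
  MkNatTrans (act_mor_natural f).

Definition action : Functor C (EndCat M).
Proof.
refine {| fob := act_ob : C -> EndCat M; fmap := act_mor |}.
- abstract (intros X; apply nat_trans_eq; intros N; apply act_hom_id).
- abstract (intros X Y Z g f; apply nat_trans_eq; intros N; simpl;
            rewrite <- act_hom_comp; now rewrite comp_idl).
Defined.

End Action.

(* [ξ_X · 1_N = β_{N,F(X)} ∘ (1_N ⊗ θ_{F(X)}) ∘ β_{F(X),N}], the morphism by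
   which [ξ_X = ξ_{1,X}] of the affinization of [C] acts on [1_N]. *)
Definition xi_act (C : BraidedStrictMonoidalCategory)
    (M : BalancedStrictMonoidalCategory) (F : BraidedMonoidalFunctor C M)
    (X : C) (N : M) : F X ⊗ N ~> F X ⊗ N :=
  braid N (F X) ∘ (idm N ⊗h twist (F X)) ∘ braid (F X) N.

(* Main.v *)
Require Import Defs.

(** Each [xi_act F X N] is the value at [Y := F X] of the morphism
    [β_{N,Y} ∘ (1_N ⊗ θ_Y) ∘ β_{Y,N}], which winds [Y] once around [N] while
    twisting it. All three factors are natural in [Y] and in [N]: the braidings
    because the braiding is natural in both arguments, the middle one because
    the twist is natural and the tensor product is a functor. Hence the
    composite commutes with [h ⊗ g] for all [h] and [g]
    ([braid_twist_braid_natural]), and so [xi_act] commutes with the action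
    [F(f) ⊗ g] of every pair of morphisms ([xi_act_natural]). Both claims are
    special cases: naturality of [Ξ_X] over [M] is the case [f = 1_X], and
    naturality of [X ↦ Ξ_X] over [C] is the case [g = 1_N], because natural
    transformations are equal as soon as their components are. *)

Lemma twist_comm (M : BalancedStrictMonoidalCategory) (Y Y' : M) (h : Y ~> Y') :
  twist Y' ∘ h = h ∘ twist Y.
Proof. exact (twist_natural h). Qed.

(** A morphism [h ⊗ g] slides through the winding: the first braiding turns it
    into [g ⊗ h], the twist lets [h] pass, and the second braiding turns it
    back into [h ⊗ g]. *)
Lemma braid_twist_braid_natural (M : BalancedStrictMonoidalCategory)
    (Y Y' N P : M) (h : Y ~> Y') (g : N ~> P) :
  braid P Y' ∘ (idm P ⊗h twist Y') ∘ braid Y' P ∘ (h ⊗h g) =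
  (h ⊗h g) ∘ (braid N Y ∘ (idm N ⊗h twist Y) ∘ braid Y N).
Proof.
rewrite <- !compA, braid_natural.
rewrite (compA (idm P ⊗h twist Y')), <- tens_comp.
rewrite comp_idl, twist_comm.
replace (g ⊗h (h ∘ twist Y)) with ((g ∘ idm N) ⊗h (h ∘ twist Y))
  by now rewrite comp_idr.
rewrite tens_comp, !compA.
now rewrite braid_natural.
Qed.

Lemma xi_act_natural (C : BraidedStrictMonoidalCategory)
    (M : BalancedStrictMonoidalCategory) (F : BraidedMonoidalFunctor C M)
    (X Y : C) (f : X ~> Y) (N P : M) (g : N ~> P) :
  xi_act F Y P ∘ act_hom F f g = act_hom F f g ∘ xi_act F X N.
Proof. apply braid_twist_braid_natural. Qed.

Theorem corollary3p3 (C : BraidedStrictMonoidalCategory)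
    (M : BalancedStrictMonoidalCategory) (F : BraidedMonoidalFunctor C M) :
  exists Xi_natural : forall X : C,
      @is_natural M M (action F X) (action F X) (fun N : M => xi_act F X N),
    @is_natural C (EndCat M) (action F) (action F)
      (fun X : C => MkNatTrans (Xi_natural X)).
Proof.
unshelve eexists.
- intros X N P g; apply xi_act_natural.
- intros X Y f; apply nat_trans_eq; intros N; apply xi_act_natural.
Qed.
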